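(* Let $c:\mathbb{N}\to(0,\infty)$ be an unbounded function with $c(n)=o(n)$ (i.e. $c(n)\ll n$), and let $p(n)=\frac{c(n)}{n}$. Then $$\mathbb{E}\big(\mathrm{gon}(G(n,p(n)))\big)\sim n,$$ i.e. $\lim_{n\to\infty}\frac{1}{n}\mathbb{E}\big(\mathrm{gon}(G(n,p(n)))\big)=1$.
   Context: $G(n,p)$ denotes the Erdős–Rényi random graph: a simple graph on $n$ labeled vertices in which each of the $\binom{n}{2}$ possible edges is present independently with probability $p$. For a finite graph $G$, a divisor is a formal integer combination $D=\sum_{v\in V(G)} D(v)\,v$ of vertices; its degree is $\sum_v D(v)$, and it is effective if $D(v)\ge 0$ for all $v$. Firing a vertex $v$ means moving one chip from $v$ along each edge incident to $v$ (so $v$ loses $\mathrm{val}(v)$ and each neighbor gains one chip per edge joining it to $v$); two divisors are equivalent if one can be obtained from the other by a sequence of firings and reverse firings (equivalently, their difference lies in the image of the graph Laplacian). A divisor $D$ has positive rank if for every vertex $v$, $D-v$ is equivalent to an effective divisor. The gonality $\mathrm{gon}(G)$ is the minimum degree of a divisor of positive rank.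
   Formalization: ''Unbounded'' is taken to mean that c(n) tends to infinity; with c merely not bounded the claim fails, e.g. for c(n) = √n for even n and c(n) = 1/2 for odd n, where isolated edges keep the expected gonality below about (1 − 1/(4e))n along odd n. *)

(* Defs.v *)
From HB Require Import structures.
From mathcomp Require Import all_boot all_order all_algebra.
From mathcomp Require Import all_classical all_reals all_analysis.
From Stdlib Require Import Relation_Operators.
Set Implicit Arguments.
Unset Strict Implicit.
Unset Printing Implicit Defensive.
Import Order.TTheory GRing.Theory Num.Theory.
Local Open Scope ring_scope.

Definition vertex_pairs (V : finType) : {set {set V}} :=
  [set e : {set V} | #|e| == 2%N].

Record sgraph (V : finType) := SGraph {
  edges :> {set {set V}};
  edges_pairs : edges \subset vertex_pairs V }.

HB.instance Definition _ (V : finType) := [isSub for @edges V].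
HB.instance Definition _ (V : finType) := [Finite of sgraph V by <:].

Section Divisors.
Variables (V : finType) (G : sgraph V).

Definition adj (u v : V) : bool := [set u; v] \in edges G.

Lemma adj_irrefl v : adj v v = false.
Proof.
apply/negP => /(fintype.subsetP (edges_pairs G)).
by rewrite inE finset.setUid cards1.
Qed.

Lemma adj_sym u v : adj u v = adj v u.
Proof. by rewrite /adj finset.setUC. Qed.

Definition valency (v : V) : nat := #|[set u | adj v u]|.

Definition divisor := {ffun V -> int}.

Definition vdiv (v : V) : divisor := [ffun u => (u == v)%:Z].

Definition degree (D : divisor) : int := \sum_v D v.

Definition effective (D : divisor) : Prop := forall v, 0 <= D v.

Definition fire (v : V) (D : divisor) : divisor :=
  [ffun u => D u + (adj v u)%:Z - (if u == v then (valency v)%:Z else 0)].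

Definition div_equiv : divisor -> divisor -> Prop :=
  clos_refl_sym_trans divisor (fun D D' => exists v, D' = fire v D).

Definition positive_rank (D : divisor) : Prop :=
  forall v, exists2 D' : divisor, div_equiv (D - vdiv v) D' & effective D'.

(* Divisors of positive rank have nonnegative degree (lemma
   [positive_rank_degree_ge0]), so it is enough to look at degrees in [nat];
   [gonalityP] shows that the minimum ranges over all divisors. *)
Definition gonality_degree (k : nat) : bool :=
  `[< exists2 D : divisor, positive_rank D & degree D = k%:Z >].

Lemma ex_gonality_degree : exists k, gonality_degree k.
Proof.
exists #|V|; apply/asboolP; exists [ffun=> 1].
- move=> v; exists (([ffun=> 1] : divisor) - vdiv v).
    exact: (rst_refl divisor).
  by move=> u; rewrite !ffunE; case: (u == v).
- rewrite /degree (eq_bigr (fun=> 1)) => [|v _]; last by rewrite ffunE.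
  by rewrite sumr_const -[#|V|%:Z]natz.
Qed.

Definition gonality : nat := ex_minn ex_gonality_degree.

Lemma degree_fire v D : degree (fire v D) = degree D.
Proof.
rewrite /degree (eq_bigr _ (fun u _ => ffunE _ u)) sumrB big_split/=.
rewrite -[X in _ - X]big_mkcond big_pred1_eq /valency cardsE -sum1_card.
rewrite (big_morph Posz PoszD (erefl _)) [in X in _ - X]big_mkcond/=.
rewrite [X in _ - X](_ : _ = \sum_u (adj v u)%:Z) ?addrK//.
by apply: eq_bigr => u _; rewrite unfold_in /adj [in RHS]unfold_in; case: ifP.
Qed.

Lemma degree_equiv D D' : div_equiv D D' -> degree D = degree D'.
Proof.
elim=> {D D'} [D D' [v ->]|//|D D' _ ->//|D1 D2 D3 _ -> _ ->//].
by rewrite degree_fire.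
Qed.

Lemma positive_rank_degree_ge0 D : positive_rank D -> 0 <= degree D.
Proof.
move=> rD; have [v _|V0] := pickP V; last by rewrite /degree big_pred0.
have [D' /degree_equiv degD' D'ge0] := rD v.
have : 0 <= degree (D - vdiv v) by rewrite degD'; apply: sumr_ge0.
rewrite /degree (eq_bigr _ (fun u _ => ffunE _ u)) big_split/=.
rewrite [X in _ + X](_ : _ = -1) ?subr_ge0; first exact: le_trans.
rewrite (bigD1 v)//= !ffunE eqxx big1 ?addr0// => u /negPf uv.
by rewrite !ffunE uv oppr0.
Qed.

Lemma gonalityP :
  (exists2 D : divisor, positive_rank D & degree D = gonality%:Z) /\
  (forall D : divisor, positive_rank D -> gonality%:Z <= degree D).
Proof.
rewrite /gonality; case: ex_minnP => k /asboolP kP kmin; split=> // D rD.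
have := positive_rank_degree_ge0 rD; case E : (degree D) => [m|//] _.
by rewrite lez_nat; apply: kmin; apply/asboolP; exists D.
Qed.

End Divisors.

Section ErdosRenyi.
Variables (R : realType) (n : nat) (p : R).

(* This is a probability mass function only when [0 <= p <= 1]; for other [p]
   it is the same polynomial expression. *)
Definition gnp_prob (G : sgraph 'I_n) : R :=
  \prod_(e in vertex_pairs 'I_n) (if e \in edges G then p else 1 - p).

Definition gnp_expectation (X : sgraph 'I_n -> R) : R :=
  \sum_(G : sgraph 'I_n) gnp_prob G * X G.

Lemma gnp_prob_sum1 : \sum_(G : sgraph 'I_n) gnp_prob G = 1.
Proof.
pose P := vertex_pairs 'I_n.
pose F (e : {set 'I_n}) := if e \in P then p else 0.
pose F' (e : {set 'I_n}) := if e \in P then 1 - p else 1.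
have : \prod_e (F e + F' e) = 1.
  by apply: big1 => e _; rewrite /F /F'; case: ifP; rewrite ?subrKC ?add0r.
rewrite bigA_distr (bigID (fun J : {set {set 'I_n}} => J \subset P))/=.
rewrite [X in _ + X]big1 ?addr0 => [|J /subsetPn[e eJ eP]]; last first.
  by rewrite (bigD1 e)//= eJ /F (negPf eP) mul0r.
rewrite (reindex_omap (@edges _) insub) => [|J JP]; last by rewrite insubT.
move=> sum1; rewrite -[RHS]sum1; apply: eq_big => [G|G _].
  by rewrite edges_pairs/= valK eqxx.
rewrite /gnp_prob [LHS]big_mkcond/=; apply: eq_bigr => e _.
rewrite /F /F' -/P; case: (boolP (e \in P)) => // eP.
by rewrite ifN//; apply: contra eP => eG; exact: (fintype.subsetP (edges_pairs G) e eG).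
Qed.

End ErdosRenyi.

(* Main.v *)
(* With high probability any two disjoint vertex sets of size at least m ~ e n
   are joined by at least n edges. In such a graph gon(G) > n - 6m. Indeed, if
   firing a script f takes an effective divisor of degree d < n to an effective
   one, then every level set of f has edge boundary at most d, so f is constant,
   say 0, outside a set of fewer than 2m vertices. Such scripts are closed under
   pointwise maximum, so a divisor of positive rank can be replaced by an
   equivalent effective divisor F from which a chip reaches each vertex v by
   firing a script h_v <= 0. On the complement S of the support of F, the set
   {h_v < 0} contains v, is small, and has no edges to the rest of S; a union of
   such sets would contradict density unless |S| < 6m, and d >= n - |S|. *)
Require Import Defs.
From mathcomp Require Import all_boot all_order all_algebra.
From mathcomp Require Import all_classical all_reals all_analysis.
From mathcomp Require Import zify ring lra.
Set Implicit Arguments.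
Unset Strict Implicit.
Unset Printing Implicit Defensive.
Import Order.TTheory GRing.Theory Num.Theory.
Import numFieldNormedType.Exports.
Local Open Scope ring_scope.

(** * Firing scripts and edge cuts *)

Section FiringScripts.
Variables (V : finType) (G : sgraph V).
Implicit Types (D E : divisor V) (f g : V -> int) (A B : {set V}).

(** This is [D] minus the graph Laplacian applied to [f]: each [w] fires [f w] times, a negative
    value meaning reverse firings. *)
Definition fire_script f D : divisor V :=
  [ffun u => D u + \sum_(w | adj G u w) (f w - f u)].

Lemma fire_scriptD f g D :
  fire_script f (fire_script g D) = fire_script (fun v => f v + g v) D.
Proof.
apply/ffunP => u; rewrite !ffunE -addrA -big_split/=; congr (_ + _).
by apply: eq_bigr => w _; lia.
Qed.

Lemma fire_script0 D : fire_script (fun=> 0) D = D.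
Proof. by apply/ffunP => u; rewrite ffunE big1 ?addr0// => w _; rewrite subrr. Qed.

Lemma fire_script_vertex v D : fire G v D = fire_script (fun w => (w == v)%:Z) D.
Proof.
apply/ffunP => u; rewrite !ffunE -addrA; congr (_ + _).
rewrite sumrB; congr (_ - _).
  rewrite big_mkcond (bigD1 v)//= eqxx big1 ?addr0; first by rewrite (adj_sym G v); case: (adj G u v).
  by move=> w /negPf ->; case: ifP.
case: (altP (u =P v)) => [->|_]; last by rewrite big1.
rewrite sumr_const /valency cardsE -[LHS]natz.
by congr (_ *+ _); apply: eq_card => w; rewrite !inE.
Qed.

Lemma div_equiv_script D E : div_equiv G D E -> exists f, E = fire_script f D.
Proof.
elim=> {D E} [D E [v ->]|D|D E _ [f ->]|D1 D2 D3 _ [f ->] _ [g ->]].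
- by exists (fun w => (w == v)%:Z); exact: fire_script_vertex.
- by exists (fun=> 0); rewrite fire_script0.
- exists (fun v => - f v); rewrite fire_scriptD -[LHS]fire_script0.
  by congr fire_script; apply/funext => v; lia.
- by exists (fun v => g v + f v); rewrite fire_scriptD.
Qed.

(** At each vertex [u] one script attains the maximum. Against that script, [u] fires equally often
    and its neighbours at least as often, so [u] ends with no fewer chips. *)
Lemma effective_max f g D :
  effective (fire_script f D) -> effective (fire_script g D) ->
  effective (fire_script (fun v => Num.max (f v) (g v)) D).
Proof.
move=> ef eg u; have := ef u; have := eg u; rewrite !ffunE => {ef eg}.
have [fg|gf] := leP (f u) (g u) => [H _|_ H].
  by apply: le_trans H _; rewrite lerD2l ler_sum// => w _; lia.
by apply: le_trans H _; rewrite lerD2l ler_sum// => w _; lia.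
Qed.

Definition cross A B : {set {set V}} := [set [set z.1; z.2] | z in finset.setX A B].

Lemma card_cross A B : [disjoint A & B] -> #|cross A B| = (#|A| * #|B|)%N.
Proof.
move=> AB; rewrite card_in_imset ?cardsX// => -[a b] [a' b'] /=.
rewrite !inE/= => /andP[aA bB] /andP[a'A b'B] e.
have d x y : x \in A -> y \in B -> (x == y) = false.
  by move=> xA yB; apply/eqP => xy; move: (disjointFr AB xA); rewrite xy yB.
have : b \in [set a'; b'] by rewrite -e !inE eqxx orbT.
have : a \in [set a'; b'] by rewrite -e !inE eqxx.
by rewrite !inE (d a b')// orbF (eq_sym b a') (d a' b)// => /eqP -> /eqP ->.
Qed.

Lemma card_edges_cross_le A B :
  (#|edges G :&: cross A B| <= \sum_(u in A) \sum_(w in B | adj G u w) 1)%N.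
Proof.
rewrite pair_big_dep/= sum1dep_card.
apply: leq_trans (leq_imset_card (fun z : V * V => [set z.1; z.2]) _).
apply: subset_leq_card; apply/fintype.subsetP => e.
rewrite inE => /andP[eG /imsetP[[a b]/=]]; rewrite inE/= => /andP[aA bB] eE.
by apply/imsetP; exists (a, b) => //; rewrite !inE aA bB /adj -eE.
Qed.

(* Summed over [A], the edges inside [A] contribute nothing to the net flow,
   and each edge leaving [A] carries at least one chip out. *)
Lemma cut_le_degree f D A :
  effective D -> effective (fire_script f D) ->
  (forall u w, u \in A -> w \notin A -> f w < f u) ->
  #|edges G :&: cross A (~: A)|%:Z <= degree D.
Proof.
move=> eD eD' fA.
have inner0 : \sum_(u in A) \sum_(w | adj G u w && (w \in A)) (f w - f u) = 0.
  under eq_bigr do rewrite sumrB.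
  apply/eqP; rewrite sumrB subr_eq0; apply/eqP.
  rewrite (exchange_big_dep (mem A))/= => [|? ? _ /andP[]//].
  apply: eq_bigr => u uA.
  by apply: congr_big => // w; rewrite uA andbT andbC adj_sym.
have : 0 <= \sum_(u in A) fire_script f D u by apply: sumr_ge0.
under eq_bigr do rewrite ffunE (bigID (mem A))/=.
rewrite !big_split/=.
rewrite inner0 add0r.
set T := (X in _ + X) => H.
have HT : T <= - (#|edges G :&: cross A (~: A)|%:Z).
  apply: (@le_trans _ _ (\sum_(u in A) - \sum_(w in ~: A | adj G u w) 1)).
    apply: ler_sum => u uA; rewrite -sumrN.
    rewrite [leRHS](eq_bigl (fun w => adj G u w && (w \notin A))).
      by apply: ler_sum => w /andP[_ wA]; have := fA _ _ uA wA; lia.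
    by move=> w; rewrite inE andbC.
  rewrite sumrN lerN2.
  have := card_edges_cross_le A (~: A); rewrite -lez_nat => /le_trans; apply.
  rewrite (big_morph Posz PoszD (erefl _)).
  by apply: ler_sum => u _; rewrite (big_morph Posz PoszD (erefl _)).
rewrite lerNr in HT; apply: le_trans HT _.
apply: (@le_trans _ _ (\sum_(u in A) D u)); first by rewrite -subr_ge0 opprK.
by rewrite /degree [leRHS](bigID (mem A))/= lerDl sumr_ge0.
Qed.
End FiringScripts.

(** * Gonality of graphs with many edges between large sets *)

Section DenseGraphs.
Variables (V : finType) (G : sgraph V).
Implicit Types (D E : divisor V) (f g : V -> int) (A B : {set V}).

Lemma degree_fire_script f D : degree (fire_script G f D) = degree D.
Proof.
rewrite /degree; under eq_bigr do rewrite ffunE.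
rewrite big_split/= -[RHS]addr0; congr (_ + _); apply/eqP.
under eq_bigr do rewrite sumrB.
rewrite sumrB subr_eq0; apply/eqP.
rewrite (exchange_big_dep xpredT)//=; apply: eq_bigr => u _.
by apply: congr_big => // w; rewrite adj_sym.
Qed.

Lemma fire_scriptB f g D :
  fire_script G (fun v => f v - g v) (fire_script G g D) = fire_script G f D.
Proof. by rewrite fire_scriptD; congr fire_script; apply/funext => v; lia. Qed.

Lemma fire_script_shift f a D :
  fire_script G (fun v => f v - a) D = fire_script G f D.
Proof.
by apply/ffunP => u; rewrite !ffunE; congr (_ + _); apply: eq_bigr => w _; lia.
Qed.

(** The script taking [D - vdiv v] to an effective [D'] takes [D] to [D'] plus one chip on [v]. *)
Lemma positive_rank_scripts D : positive_rank G D -> 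
  forall v, exists2 f, effective (fire_script G f D) & 0 < fire_script G f D v.
Proof.
move=> rD v; have [D' /div_equiv_script[f D'E] D'0] := rD v.
have fE u : fire_script G f D u = D' u + (u == v)%:Z.
  by rewrite D'E !ffunE [RHS]addrAC subrK.
exists f => [u|]; rewrite fE; last by rewrite eqxx ltr_pwDr.
by rewrite addr_ge0.
Qed.

(** The threshold [#|V|] exceeds the degree of the divisors considered below, so [cut_le_degree]
    rules out a level cut with [m] vertices on both sides. *)
Definition dense_pairs m := [forall A : {set V}, forall B : {set V},
  [&& [disjoint A & B], m <= #|A| & m <= #|B|]%N ==>
  (#|V| <= #|edges G :&: cross A B|)%N].

Variable m : nat.
Hypotheses (m_gt0 : (0 < m)%N) (Gm : dense_pairs m).

Lemma dense_pairsP A B : [disjoint A & B] -> (m <= #|A|)%N -> (m <= #|B|)%N ->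
  (#|V| <= #|edges G :&: cross A B|)%N.
Proof.
by move=> AB mA mB; move/forallP/(_ A)/forallP/(_ B): Gm; rewrite AB mA mB.
Qed.

(** Every level cut of [f] has a side smaller than [m]. The constant is the largest value of [f]
    with fewer than [m] vertices strictly below it. *)
Lemma script_mostly_const f D :
  effective D -> effective (fire_script G f D) -> degree D < #|V|%:Z ->
  exists a, (#|[set v | f v != a]%SET| < 2 * m)%N.
Proof.
move=> D0 fD0 Dlt.
have lev (i : int) : (#|[set v | (i <= f v)%R]%SET| < m)%N \/
             (#|[set v | (f v < i)%R]%SET| < m)%N.
  set A := [set v | (i <= f v)%R]%SET.
  have -> : [set v | (f v < i)%R]%SET = ~: A by apply/finset.setP => v; rewrite !inE ltNge.
  have [mA|] := leqP m #|A|; last by left.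
  have [mA'|] := leqP m #|~: A|; last by right.
  have cut : #|edges G :&: cross A (~: A)|%:Z <= degree D.
    apply: (cut_le_degree D0 fD0) => u w.
    by rewrite !inE -ltNge => /[swap]; apply: lt_le_trans.
  have AC : [disjoint A & ~: A] by rewrite -setI_eq0 finset.setICr.
  have := dense_pairsP AC mA mA'.
  by move=> ?; have := le_lt_trans cut Dlt; rewrite ltz_nat ltnNge => /negP.
have [v0 _|V0] := pickP V; last first.
  by exists 0; rewrite eq_card0 ?muln_gt0 ?m_gt0 // => v; by move: (V0 v).
pose low v := [set w | (f w < f v)%R]%SET.
have [vmin _ fmin] := Order.TotalTheory.arg_minP f (isT : xpredT v0).
have Pmin : (#|low vmin| < m)%N.
  by rewrite eq_card0// => w; rewrite !inE ltNge fmin.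
case: (Order.TotalTheory.arg_maxP (P := fun v => (#|low v| < m)%N) f Pmin) => v Pv fmax.
exists (f v).
(* Let [f w] be the next value above [f v]. If the upper side of the cut at [f w] were not small,
   the lower side would be, against the maximality of [f v]. *)
have high : (#|[set w | (f v < f w)%R]%SET| < m)%N.
  have [w0 w0P|none] := pickP (fun w => f v < f w); last first.
    by rewrite eq_card0// => w; rewrite !inE none.
  case: (Order.TotalTheory.arg_minP (P := fun w => f v < f w) f w0P) => w wv wmin.
  have -> : [set w | (f v < f w)%R]%SET = [set x | (f w <= f x)%R]%SET.
    apply/finset.setP => x; rewrite !inE; apply/idP/idP; first exact: wmin.
    exact: lt_le_trans.
  have [//|Pw] := lev (f w).
  by have : f w <= f v := fmax _ Pw; rewrite leNgt wv.
apply: (@leq_ltn_trans (#|low v| + #|[set w | (f v < f w)%R]%SET|)).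
  apply: leq_trans (leq_card_setU _ _).
  by apply/subset_leq_card/fintype.subsetP => w; rewrite !inE neq_lt.
by move: Pv high; lia.
Qed.


(** The maximum is mostly equal to some [a]. If [a] were nonzero, three exceptional sets of size
    below [2 * m] would cover [V], which has at least [6 * m] vertices. *)
Lemma fire_script_small_max f g D :
  effective D -> degree D < #|V|%:Z -> (6 * m <= #|V|)%N ->
  effective (fire_script G f D) -> (#|[set v | f v != 0]%SET| < 2 * m)%N ->
  effective (fire_script G g D) -> (#|[set v | g v != 0]%SET| < 2 * m)%N ->
  (#|[set v | Num.max (f v) (g v) != 0]%SET| < 2 * m)%N.
Proof.
move=> D0 Dlt mV fD fs gD gs.
have [a] := script_mostly_const D0 (effective_max fD gD) Dlt.
have [->//|a0 ha] := eqVneq a 0; exfalso.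
have : (#|V| <= #|[set v | Num.max (f v) (g v) != a]%SET| +
          (#|[set v | f v != 0]%SET| + #|[set v | g v != 0]%SET|))%N.
  apply: leq_trans (leq_add (leqnn _) (leq_card_setU _ _)).
  apply: leq_trans (leq_card_setU _ _).
  apply/subset_leq_card/fintype.subsetP => v _; rewrite !inE.
  apply: contraNT a0; rewrite !negb_or !negbK => /and3P[/eqP<- /eqP-> /eqP->].
  by rewrite maxxx.
by move: ha fs gs mV; move: #|_| #|_| #|_| #|V| => *; lia.
Qed.

Lemma fire_script_upper_bound D (g : V -> V -> int) :
  effective D -> degree D < #|V|%:Z -> (6 * m <= #|V|)%N ->
  (forall v, effective (fire_script G (g v) D) /\
             (#|[set w | g v w != 0]%SET| < 2 * m)%N) ->
  exists f, [/\ effective (fire_script G f D),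
    (#|[set w | f w != 0]%SET| < 2 * m)%N & forall v w, g v w <= f w].
Proof.
move=> D0 Dlt mV gP.
suff [f [fD fs fg]] : exists f, [/\ effective (fire_script G f D),
    (#|[set w | f w != 0]%SET| < 2 * m)%N &
    {in enum V, forall v w, g v w <= f w}].
  by exists f; split=> // v w; apply: fg; rewrite mem_enum.
elim: (enum V) => [|v s [f [fD fs fg]]].
  exists (fun=> 0); rewrite fire_script0; split=> //.
  by rewrite eq_card0 ?muln_gt0 ?m_gt0// => v; rewrite !inE eqxx.
have [gD gs] := gP v.
exists (fun w => Num.max (f w) (g v w)); split=> [||u].
- exact: effective_max.
- exact: fire_script_small_max.
rewrite inE => /predU1P[-> w|us w]; first by rewrite le_max lexx orbT.
by rewrite le_max fg.
Qed.

(* [S] is covered by small sets with no edge to the rest of [S]; a greedy union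
   of these has size between [m] and [5 * m], against density. *)
Lemma covered_small (S : {set V}) (N : V -> {set V}) :
  (0 < #|V|)%N ->
  (forall v, v \in S -> v \in N v) -> (forall v, N v \subset S) ->
  (forall v, #|N v| <= 4 * m)%N ->
  (forall v x y, x \in N v -> y \in S -> y \notin N v -> ~~ adj G x y) ->
  (#|S| < 6 * m)%N.
Proof.
move=> V_gt0 NS NsubS Nsmall Nclosed; rewrite ltnNge; apply/negP => mS.
pose closed (W : {set V}) := W \subset S /\
  forall x y, x \in W -> y \in S -> y \notin W -> ~~ adj G x y.
(* No closed set has size in the range from [m] to [5 * m]. Adding one [N v], of size at most
   [4 * m], to a closed set smaller than [m] cannot jump over this gap. *)
have closed_small W : closed W -> (#|W| <= 5 * m)%N -> (#|W| < m)%N.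
  move=> [WS Wcl] W5; rewrite ltnNge; apply/negP => mW.
  have mB : (m <= #|S :\: W|)%N.
    by rewrite cardsD (finset.setIidPr WS); move: mS W5; lia.
  have WB : [disjoint W & S :\: W].
    by rewrite -setI_eq0 finset.setDE finset.setICA finset.setICr finset.setI0.
  have := dense_pairsP WB mW mB; rewrite leqNgt => /negP; apply.
  rewrite eq_card0// => e; apply/negP; rewrite !inE => /andP[eG].
  move=> /imsetP[[x y]]; rewrite !inE/= => /and3P[xW yW yS] eE.
  by have := Wcl x y xW yS yW; rewrite /adj -eE eG.
have [W [[WS Wcl] Wm WN]] : exists W, [/\ closed W, (#|W| < m)%N &
    {in enum V, forall v, v \in S -> v \in W}].
  elim: (enum V) => [|v s [W [[WS Wcl] Wm Ws]]].
    exists finset.set0; split=> //; last by rewrite cards0.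
    by split=> [|x y]; rewrite ?finset.sub0set ?inE.
  have cl : closed (W :|: N v).
    split=> [|x y]; first by rewrite finset.subUset WS NsubS.
    rewrite !inE negb_or => /orP[xW|xN] yS /andP[yW yN]; first exact: Wcl.
    exact: Nclosed yN.
  exists (W :|: N v); split=> //.
    apply: closed_small => //; apply: leq_trans (leq_card_setU _ _) _.
    by have := Nsmall v; move: Wm; move: #|_| #|_| => *; lia.
  move=> u; rewrite inE => /predU1P[-> /NS|us uS]; rewrite inE.
    by move=> ->; rewrite orbT.
  by rewrite Ws.
have : (#|S| <= #|W|)%N.
  by apply/subset_leq_card/fintype.subsetP => v; apply: WN; rewrite mem_enum.
by move: Wm mS; move: #|_| #|_| => *; lia.
Qed.

Lemma gonality_dense : (#|V| < gonality G + 6 * m)%N.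
Proof.
rewrite ltnNge; apply/negP => gV.
have V_gt0 : (0 < #|V|)%N by move: gV m_gt0; move: #|V| (gonality G) => *; lia.
have /card_gt0P[v0 _] := V_gt0.
have [[D rD degD] _] := gonalityP G.
have [f0 D0 _] := positive_rank_scripts rD v0.
set E := fire_script G f0 D in D0.
have degE : degree E = (gonality G)%:Z by rewrite degree_fire_script.
have Elt : degree E < #|V|%:Z by rewrite degE ltz_nat; move: gV m_gt0; lia.
have mV : (6 * m <= #|V|)%N by move: gV; move: #|V| (gonality G) => *; lia.
have /choice[g gP] : forall v, exists g : V -> int,
    [/\ effective (fire_script G g E), 0 < fire_script G g E v &
        (#|[set w | g w != 0]%SET| < 2 * m)%N].
  move=> v; have [f fD fv] := positive_rank_scripts rD v.
  rewrite -(fire_scriptB f f0) -/E in fD fv.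
  have [a fa] := script_mostly_const D0 fD Elt.
  (* Subtracting [f0] makes the script start from [E]; subtracting the constant [a], which moves no
     chips, makes it vanish off a small set. *)
  exists (fun w => f w - f0 w - a); rewrite fire_script_shift; split=> //.
  by under eq_finset do rewrite subr_eq0.
have /(fire_script_upper_bound D0 Elt mV)[f [fD fs gf]] : forall v,
    effective (fire_script G (g v) E) /\
    (#|[set w | g v w != 0]%SET| < 2 * m)%N.
  by move=> v; have [? _ ?] := gP v.
set F := fire_script G f E in fD.
have hF v : fire_script G (fun w => g v w - f w) F = fire_script G (g v) E.
  by rewrite fire_scriptB.
pose S := [set v | F v == 0]%SET.
have : (#|S| < 6 * m)%N.
  apply: (@covered_small S (fun v => [set w in S | g v w != f w])%SET) => //.
  (* The script [g v - f] is nowhere positive. If it vanished at [v], no chip could arrive there,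
     yet [v] goes from no chips to at least one. *)
  - move=> v; rewrite !inE => /eqP Fv0; rewrite Fv0 eqxx/=; apply/eqP => gfv.
    have [_ + _] := gP v; rewrite -hF ffunE Fv0 add0r ltNge => /negP; apply.
    by apply: sumr_le0 => w _; rewrite gfv subrr subr0 subr_le0.
  - by move=> v; apply/fintype.subsetP => w; rewrite inE => /andP[].
  - move=> v; have [_ _ gs] := gP v.
    apply: (@leq_trans (#|[set w | g v w != 0]%SET| + #|[set w | f w != 0]%SET|)).
      apply: leq_trans (leq_card_setU _ _).
      apply/subset_leq_card/fintype.subsetP => w; rewrite !inE => /andP[_].
      by apply: contraNT; rewrite negb_or !negbK => /andP[/eqP -> /eqP ->].
    by move: gs fs; move: #|_| #|_| => *; lia.
  (* A chipless [y] where [g v - f] vanishes would go into debt if a neighbour [x] had a negative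
     value. *)
  - move=> v x y; rewrite !inE => /andP[_ gfx] Fy0.
    rewrite Fy0 negbK => /eqP gfy; apply/negP => xy.
    have [/(_ y)] := gP v; rewrite -hF ffunE (eqP Fy0) add0r leNgt => /negP + _ _; apply.
    rewrite adj_sym in xy; rewrite (bigD1 x xy) gfy subrr subr0.
    apply: ltr_wnDr; last by rewrite subr_lt0 lt_neqAle gfx gf.
    by apply: sumr_le0 => w _; rewrite subr0 subr_le0.
rewrite ltnNge => /negP; apply.
(* [F] has a chip on every vertex outside [S], and its degree is the gonality. *)
have : (#|~: S|%:Z <= degree F).
  rewrite /degree (bigID (mem S))/= -[leLHS]add0r lerD ?sumr_ge0//.
  rewrite -sum1_card (big_morph Posz PoszD (erefl _)).
  rewrite (eq_bigl (fun v => v \notin S)); last by move=> v; rewrite inE.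
  apply: ler_sum => v; rewrite inE => Fv0.
  by have := fD v; rewrite le_eqVlt eq_sym (negPf Fv0)/=.
rewrite degree_fire_script degE lez_nat.
by have := cardsC S; move: gV; move: #|V| #|~: S| #|S| (gonality G) => *; lia.
Qed.

End DenseGraphs.

(** * Expectations over the random graph *)

Lemma sum_sgraph_prod (R : comPzRingType) (V : finType) (a b : {set V} -> R) :
  \sum_(G : sgraph V) \prod_(e in vertex_pairs V)
     (if e \in edges G then a e else b e) =
  \prod_(e in vertex_pairs V) (a e + b e).
Proof.
(* Giving each set that is not a pair the factor [0 + 1] extends the product to all sets; in its
   expansion only sets of pairs survive, and these are the graphs. *)
pose F e := if e \in vertex_pairs V then a e else 0.
pose F' e := if e \in vertex_pairs V then b e else 1.
transitivity (\prod_e (F e + F' e)); last first.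
  rewrite [RHS]big_mkcond; apply: eq_bigr => e _.
  by rewrite /F /F'; case: ifP; rewrite ?add0r.
rewrite bigA_distr (bigID (fun J : {set {set V}} => J \subset vertex_pairs V))/=.
rewrite [X in _ + X]big1 ?addr0 => [|J /subsetPn[e eJ eP]]; last first.
  by rewrite (bigD1 e)//= eJ /F (negPf eP) mul0r.
rewrite [RHS](reindex_omap (@edges _) insub) => [|J JP]; last by rewrite insubT.
apply: eq_big => [G|G _]; first by rewrite edges_pairs/= valK eqxx.
rewrite [LHS]big_mkcond/=; apply: eq_bigr => e _.
rewrite /F /F'; case: (boolP (e \in vertex_pairs V)) => // eP.
by rewrite ifN//; apply: contra eP; apply: (fintype.subsetP (edges_pairs G)).
Qed.

Lemma cross_sub_pairs (V : finType) (A B : {set V}) :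
  [disjoint A & B] -> cross A B \subset vertex_pairs V.
Proof.
move=> AB; apply/fintype.subsetP => e /imsetP[[x y]]; rewrite inE/= => /andP[xA yB] ->.
rewrite inE cards2; have [xy|//] := eqVneq x y.
by move: (disjointFr AB xA); rewrite xy yB.
Qed.

(** By independence, each of the [#|A| * #|B|] crossing pairs contributes a factor
    [p / 2 + (1 - p)], and every other pair contributes 1. *)
Lemma gnp_half_cross (R : realType) n (p : R) (A B : {set 'I_n}) :
  [disjoint A & B] ->
  gnp_expectation p (fun G => 2^-1 ^+ #|edges G :&: cross A B|) =
  (1 - p / 2) ^+ (#|A| * #|B|).
Proof.
move=> AB; pose h e : R := if e \in cross A B then 2^-1 else 1.
transitivity (\sum_(G : sgraph 'I_n) \prod_(e in vertex_pairs 'I_n)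
     (if e \in edges G then p * h e else 1 - p)).
  apply: eq_bigr => G _; rewrite /gnp_prob.
  have -> : 2^-1 ^+ #|edges G :&: cross A B| =
      \prod_(e in vertex_pairs 'I_n) (if e \in edges G then h e else 1).
    rewrite -prodr_const big_mkcond [RHS]big_mkcond; apply: eq_bigr => e _.
    rewrite inE /h; case: (boolP (e \in edges G)) => [eG|_]; last by case: ifP.
    by rewrite (fintype.subsetP (edges_pairs G) _ eG); case: ifP.
  rewrite -big_split/=; apply: eq_bigr => e _.
  by case: ifP; rewrite ?mulr1.
rewrite sum_sgraph_prod -card_cross// -prodr_const big_mkcond [RHS]big_mkcond.
apply: eq_bigr => e _; rewrite /h; case: (boolP (e \in cross A B)) => [eX|_].
  by rewrite (fintype.subsetP (cross_sub_pairs AB) _ eX); lra.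
by rewrite mulr1 subrKC if_same.
Qed.

Lemma gnp_prob_ge0 (R : realType) n (p : R) (G : sgraph 'I_n) :
  0 <= p <= 1 -> 0 <= gnp_prob p G.
Proof.
move=> /andP[p0 p1]; apply: prodr_ge0 => e _; case: ifP => // _.
by rewrite subr_ge0.
Qed.

(* Markov's inequality for [2^-e(A, B)], and a union bound over [A] and [B]. *)
Lemma gnp_not_dense (R : realType) n (p : R) m : 0 <= p <= 1 ->
  gnp_expectation p (fun G : sgraph 'I_n => (~~ dense_pairs G m)%:R) <=
  8 ^+ n * (1 - p / 2) ^+ (m * m).
Proof.
move=> p01; have [p0 p1] := andP p01.
pose ok (z : {set 'I_n} * {set 'I_n}) := 
  [&& [disjoint z.1 & z.2], (m <= #|z.1|)%N & (m <= #|z.2|)%N].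
pose t (G : sgraph 'I_n) z : R := 2^-1 ^+ #|edges G :&: cross z.1 z.2|.
have t0 G z : 0 <= t G z by rewrite exprn_ge0// invr_ge0.
(* If [G] is not dense, some admissible pair has fewer than [n] crossing edges, and its term
   [2 ^+ n * t G z] is at least 1. *)
apply: (@le_trans _ _ (\sum_(G : sgraph 'I_n) \sum_(z | ok z)
    2 ^+ n * (gnp_prob p G * t G z))).
  apply: ler_sum => G _; under [leRHS]eq_bigr do rewrite mulrCA.
  rewrite -mulr_sumr ler_wpM2l ?gnp_prob_ge0//.
  have [_|] := boolP (dense_pairs G m).
    by apply: sumr_ge0 => z _; rewrite mulr_ge0 ?exprn_ge0.
  move=> /forallPn[A /forallPn[B]]; rewrite negb_imply => /andP[okAB].
  rewrite card_ord -ltnNge => lt_n.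
  rewrite (bigD1 (A, B))//= ler_wpDr//.
    by apply: sumr_ge0 => z _; rewrite mulr_ge0 ?exprn_ge0.
  rewrite /t/= exprVn ler_pdivlMr ?exprn_gt0// mul1r.
  by rewrite ler_weXn2l ?ler1n// ltnW.
rewrite exchange_big/=.
apply: (@le_trans _ _ (\sum_(z | ok z) 2 ^+ n * (1 - p / 2) ^+ (m * m))).
  apply: ler_sum => -[A B] /and3P[/= AB mA mB]; rewrite -mulr_sumr ler_wpM2l ?exprn_ge0//.
  rewrite [leLHS](gnp_half_cross p AB) ler_wiXn2l ?leq_mul//; lra.
(* There are at most [2 ^ n * 2 ^ n] pairs of sets; the last [2 ^+ n] is the Markov factor. *)
have -> : 8 ^+ n = (2 ^ n * 2 ^ n)%:R * 2 ^+ n :> R.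
  by rewrite natrM !natrX -!exprMn -!natrM.
rewrite sumr_const -[leLHS]mulr_natl -[leRHS]mulrA ler_wpM2r//.
  by rewrite mulr_ge0 ?exprn_ge0//; lra.
rewrite ler_nat.
apply: leq_trans (max_card _) _.
rewrite card_prod (_ : #|{set 'I_n}| = 2 ^ n)%N//.
by rewrite -cardsT -powersetT card_powerset cardsT card_ord.
Qed.

(** * Bounds on the expected gonality *)

Lemma gonality_le_card (V : finType) (G : sgraph V) : (gonality G <= #|V|)%N.
Proof.
have [_ /(_ [ffun=> 1])] := gonalityP G; rewrite -lez_nat => min.
apply: le_trans (min _) _.
  move=> v; exists (([ffun=> 1] : divisor V) - vdiv v).
    exact: Relation_Operators.rst_refl.
  by move=> u; rewrite !ffunE; case: (u == v).
rewrite /degree (eq_bigr (fun=> 1)) => [|v _]; last by rewrite ffunE.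
by rewrite sumr_const natz.
Qed.

Lemma gnp_gonality_le (R : realType) n (p : R) : 0 <= p <= 1 ->
  gnp_expectation p (fun G : sgraph 'I_n => (gonality G)%:R) <= n%:R.
Proof.
move=> p01.
have -> : n%:R = \sum_(G : sgraph 'I_n) gnp_prob p G * n%:R :> R.
  by rewrite -mulr_suml gnp_prob_sum1 mul1r.
apply: ler_sum => G _; rewrite ler_wpM2l ?gnp_prob_ge0// ler_nat.
by rewrite (leq_trans (gonality_le_card G))// card_ord.
Qed.

(** Dense graphs satisfy [gonality_dense]; on the others, subtracting a further [n] makes the bound
    nonpositive. *)
Lemma gnp_gonality_ge (R : realType) n (p : R) m : 0 <= p <= 1 -> (0 < m)%N ->
  n%:R - (6 * m)%:R - n%:R * (8 ^+ n * (1 - p / 2) ^+ (m * m)) <=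
  gnp_expectation p (fun G : sgraph 'I_n => (gonality G)%:R).
Proof.
move=> p01 m0.
apply: (@le_trans _ _ (n%:R - (6 * m)%:R - n%:R *
    gnp_expectation p (fun G : sgraph 'I_n => (~~ dense_pairs G m)%:R))).
  by rewrite lerB// ler_wpM2l// gnp_not_dense.
have -> : n%:R - (6 * m)%:R =
    \sum_(G : sgraph 'I_n) gnp_prob p G * (n%:R - (6 * m)%:R) :> R.
  by rewrite -mulr_suml gnp_prob_sum1 mul1r.
rewrite mulr_sumr -sumrB.
apply: ler_sum => G _; rewrite mulrCA -mulrBr ler_wpM2l ?gnp_prob_ge0//.
have [dG|_] := boolP (dense_pairs G m); rewrite ?mulr0 ?mulr1 ?subr0.
  have := gonality_dense m0 dG; rewrite card_ord => /ltnW.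
  by rewrite -(ler_nat R) natrD lerBlDr.
by rewrite addrAC subrr sub0r (le_trans _ (ler0n _ _))// oppr_le0.
Qed.

(** * Choice of the set size and passage to the limit *)

Lemma half_expn_le_invn (R : realType) n : (0 < n)%N -> 2^-1 ^+ n <= n%:R^-1 :> R.
Proof.
move=> n0; rewrite exprVn lef_pV2 ?posrE ?exprn_gt0 ?ltr0n//.
by rewrite -natrX ler_nat ltnW// ltn_expl.
Qed.

(** With [p = c / n], [1 - p / 2 <= expR (- (p / 2))], and the exponent [m * m * p / 2] is at least
    [n * c * e ^+ 2 / 2 >= 16 * n]. Since [expR (- 16) <= 1 / 16], the left side is at most
    [(8 / 16) ^+ n]. *)
Lemma gnp_union_bound_le_invn (R : realType) n (c e : R) m :
  0 <= e -> (0 < n)%N -> e * n%:R <= m%:R -> 0 <= c <= n%:R -> 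
  32 <= c * e ^+ 2 ->
  8 ^+ n * (1 - c / n%:R / 2) ^+ (m * m) <= n%:R^-1.
Proof.
move=> e0 n0 em /andP[c0 cn] ce.
have n0R : 0 < n%:R :> R by rewrite ltr0n.
set p := c / n%:R.
have p01 : 0 <= p <= 1 by rewrite divr_ge0 ?ler_pdivrMr ?mul1r//= ltW.
apply: le_trans (half_expn_le_invn R n0).
apply: (@le_trans _ _ (8 ^+ n * 16^-1 ^+ n)); last first.
  by rewrite -exprMn lerXn2r ?nnegrE//; lra.
rewrite ler_wpM2l ?exprn_ge0//.
apply: (@le_trans _ _ (expR (- 16) ^+ n)); last first.
  rewrite lerXn2r ?nnegrE ?expR_ge0 ?invr_ge0// expRN lef_pV2 ?posrE ?expR_gt0//.
  by apply: le_trans (expR_ge1Dx 16); lra.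
apply: (@le_trans _ _ (expR (- (p / 2)) ^+ (m * m))).
  by rewrite lerXn2r ?nnegrE ?expR_ge0 ?expR_ge1Dx//; lra.
rewrite -!expRM_natl ler_expR !mulrN lerN2 natrM.
apply: (@le_trans _ _ ((e * n%:R) ^+ 2 * (p / 2))).
  have -> : (e * n%:R) ^+ 2 * (p / 2) = n%:R * (c * e ^+ 2 / 2).
    by rewrite /p; field; rewrite gt_eqF.
  by rewrite ler_wpM2l//; lra.
rewrite ler_wpM2r//; first by lra.
by rewrite expr2 ler_pM// mulr_ge0.
Qed.

(** Sets of size [m.+1], with [m] the integer part of [e * n], cost [6 * m.+1 <= 6 * e * n + 6], and
    the non-dense graphs cost at most 1. As [1 <= e * n], the total is at most
    [(6 + 6 + 1) * e * n]. *)
Lemma gnp_gonality_lower (R : realType) n (c e : R) :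
  0 < e -> (0 < n)%N -> 0 <= c <= n%:R -> 32 <= c * e ^+ 2 -> e^-1 <= n%:R ->
  1 - 13 * e <=
  gnp_expectation (c / n%:R) (fun G : sgraph 'I_n => (gonality G)%:R) / n%:R.
Proof.
move=> e0 n0 c0n ce en.
have n0R : 0 < n%:R :> R by rewrite ltr0n.
have p01 : 0 <= c / n%:R <= 1.
  by have [? ?] := andP c0n; rewrite divr_ge0 ?ler_pdivrMr ?mul1r//= ltW.
have /truncn_itv/andP[mle /ltW mge] : 0 <= e * n%:R by rewrite mulr_ge0 ?ltW.
set m := Num.truncn _ in mle mge.
have := gnp_gonality_ge n p01 (ltn0Sn m).
have bad := gnp_union_bound_le_invn (ltW e0) n0 mge c0n ce.
rewrite ler_pdivlMr//; apply: le_trans.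
have {}en : 1 <= e * n%:R by rewrite mulrC -ler_pdivrMr// mul1r.
have : n%:R * (8 ^+ n * (1 - c / n%:R / 2) ^+ (m.+1 * m.+1)) <= 1 :> R.
  by rewrite mulrC -ler_pdivlMr// mul1r.
rewrite natrM -[m.+1%:R]natr1; lra.
Qed.

Local Open Scope classical_set_scope.

Theorem theorem1p1 (R : realType) (c : nat -> R)
    (c_gt0 : forall n, 0 < c n)
    (c_unbounded : c n @[n --> \oo] --> +oo)
    (c_littleo : c =o_\oo (fun n : nat => n%:R : R)) :
  gnp_expectation (c n / n%:R) (fun G : sgraph 'I_n => (gonality G)%:R) / n%:R
    @[n --> \oo] --> (1 : R).
Proof.
apply/cvgrPdist_le => e e0.
(* The little-o hypothesis with constant 1 makes [c n / n] a probability for large [n]. *)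
have c_le : \forall n \near \oo, c n <= n%:R.
  move: c_littleo => /eqoP/(_ 1 ltr01).
  apply: filterS => n; rewrite mul1r /= (ger0_norm (ltW (c_gt0 n))).
  by rewrite ger0_norm.
near=> n.
have n0 : (0 < n)%N by near: n; exact: nbhs_infty_gt.
have p01 : 0 <= c n / n%:R <= 1.
  rewrite divr_ge0 ?(ltW (c_gt0 n))//= ler_pdivrMr ?ltr0n// mul1r.
  by near: n.
have le1 : gnp_expectation (c n / n%:R) (fun G : sgraph 'I_n => (gonality G)%:R)
    / n%:R <= 1.
  by rewrite ler_pdivrMr ?ltr0n// mul1r gnp_gonality_le.
rewrite ger0_norm ?subr_ge0// lerBlDr -lerBlDl.
(* The choice [e / 13] turns the loss [13 * e] of the lower bound into the given [e]. *)
apply: le_trans (gnp_gonality_lower (e := e / 13) _ n0 _ _ _).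
- by rewrite mulrC divfK.
- by rewrite divr_gt0.
- rewrite (ltW (c_gt0 n))/=; near: n; exact: c_le.
- rewrite -ler_pdivrMr ?exprn_gt0 ?divr_gt0//.
  near: n; move/cvgryPge : c_unbounded; exact.
- near: n; exact: nbhs_infty_ger.
Unshelve. all: by end_near.
Qed.
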